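(* Let $d_1, d_2$ be two positive integers such that $d_1 \ne d_2$, and let $\nu$ be a rational number in the open interval $(0,1)$. Then there exists a positive integer $n$ such that $n_1 = (1-\nu)n$ and $n_2 = \nu n$ are integers and $\rho(\mathcal{G}_{d_1,n_1,d_2,n_2}) = \rho(\mathcal{M}_{d_1,n_1,d_2,n_2})$ if and only if $\nu$ belongs to the set $$\left\{ \frac{i}{d_2+i} : i = 1,\ldots,d_1-1\right\} \cup \left\{ \frac{d_1}{d_1+i} : i = 1,\ldots,d_2\right\}.$$ Moreover, if $\nu$ belongs to this set, then $\rho(\mathcal{G}_{d_1,n_1,d_2,n_2}) = \rho(\mathcal{M}_{d_1,n_1,d_2,n_2})$, with $n_1 = (1-\nu)n$ and $n_2 = \nu n$ integers, holds for infinitely many values of $n$.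
   Context: $\mathcal{M}_{d_1,n_1,d_2,n_2}$ is the set of symmetric $n\times n$ real matrices with non-negative entries (diagonal entries may be non-zero), $n = n_1+n_2$, having $n_1$ rows of sum $d_1$ and $n_2$ rows of sum $d_2$; $\rho(\mathcal{M}_{d_1,n_1,d_2,n_2})$ is the minimum of the spectral radius $\rho(M)$ over $M$ in this (compact) set. $\mathcal{G}_{d_1,n_1,d_2,n_2}$ is the family of simple undirected graphs (not necessarily connected) on $n_1+n_2$ vertices with $n_1$ vertices of degree $d_1$ and $n_2$ vertices of degree $d_2$; $\rho(\mathcal{G}_{d_1,n_1,d_2,n_2})$ is the minimum over $G$ in this family of the spectral radius $\rho(G)$ of the adjacency matrix of $G$. If the family $\mathcal{G}_{d_1,n_1,d_2,n_2}$ is empty, the equality $\rho(\mathcal{G}_{d_1,n_1,d_2,n_2}) = \rho(\mathcal{M}_{d_1,n_1,d_2,n_2})$ is regarded as false. *)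

(* Defs.v *)
From mathcomp Require Import all_boot all_order all_algebra.
From mathcomp Require Import complex.
From mathcomp Require Import all_classical all_reals.

Set Implicit Arguments.
Unset Strict Implicit.
Unset Printing Implicit Defensive.

Import Order.TTheory GRing.Theory Num.Theory.

Local Open Scope classical_set_scope.
Local Open Scope ring_scope.

(* Largest modulus of a complex eigenvalue. For n > 0 the set of moduli is
   finite and nonempty, so that the supremum is a maximum. *)
Definition spectral_radius (R : realType) (n : nat) (A : 'M[R]_n) : R :=
  sup [set ComplexField.Normc.normc z | z in
        [set z : R[i] | eigenvalue (map_mx (real_complex R) A) z]].

Definition row_sum (R : realType) (n : nat) (A : 'M[R]_n) (i : 'I_n) : R :=
  \sum_(j < n) A i j.

(* Row sums are prescribed by counting: when d1 != d2 the two sets of rows are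
   disjoint, hence cover all n1 + n2 rows. The same holds for the degrees in
   [in_G]. *)
Definition in_M (R : realType) (d1 n1 d2 n2 : nat) (A : 'M[R]_(n1 + n2)) :
    Prop :=
  [/\ A^T = A,
      forall i j, 0 <= A i j,
      #|[set i | row_sum A i == d1%:R]%SET| = n1 &
      #|[set i | row_sum A i == d2%:R]%SET| = n2].

Definition degree (n : nat) (e : rel 'I_n) (i : 'I_n) : nat :=
  #|[set j | e i j]%SET|.

Definition in_G (d1 n1 d2 n2 : nat) (e : rel 'I_(n1 + n2)) : Prop :=
  [/\ symmetric e,
      irreflexive e,
      #|[set i | degree e i == d1]%SET| = n1 &
      #|[set i | degree e i == d2]%SET| = n2].

Definition adjacency (R : realType) (n : nat) (e : rel 'I_n) : 'M[R]_n :=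
  \matrix_(i, j) (e i j)%:R.

Definition is_minimum (R : realType) (S : set R) (r : R) : Prop :=
  S r /\ lbound S r.

Definition is_rho_M (R : realType) (d1 n1 d2 n2 : nat) : R -> Prop :=
  is_minimum [set x | exists2 A : 'M[R]_(n1 + n2),
                        in_M d1 d2 A & x = spectral_radius A].

Definition is_rho_G (R : realType) (d1 n1 d2 n2 : nat) : R -> Prop :=
  is_minimum [set x | exists2 e : rel 'I_(n1 + n2),
                        in_G d1 d2 e & x = spectral_radius (adjacency R e)].

(* Both minima exist and coincide; in particular this is false when the family
   of graphs is empty. *)
Definition rho_G_eq_rho_M (R : realType) (d1 n1 d2 n2 : nat) : Prop :=
  exists r : R, is_rho_G d1 n1 d2 n2 r /\ is_rho_M d1 n1 d2 n2 r.

Definition equality_at (R : realType) (d1 d2 : nat) (nu : rat) (n : nat) :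
    Prop :=
  (0 < n)%N /\
  exists n1 n2 : nat,
    [/\ n1%:R = (1 - nu) * n%:R,
        n2%:R = nu * n%:R &
        rho_G_eq_rho_M R d1 n1 d2 n2].

Definition critical_ratios (d1 d2 : nat) : set rat :=
  [set i%:R / (d2 + i)%:R | i in [set i : nat | (1 <= i <= d1 - 1)%N]] `|`
  [set d1%:R / (d1 + i)%:R | i in [set i : nat | (1 <= i <= d2)%N]].

(* Main.v *)
Require Import Defs.
From mathcomp Require Import all_boot all_order all_algebra.
From mathcomp Require Import all_classical all_reals.
From mathcomp Require Import complex ring lra.

Import Order.TTheory GRing.Theory Num.Theory.

Local Open Scope classical_set_scope.
Local Open Scope ring_scope.

(** Let [p] and [q] be the two prescribed sums, [S] the set of the [a] rows of
    sum [p], [b] the number of the other rows, and suppose [a * p <= b * q].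
    Averaging a matrix over the two classes gives a 2 x 2 quotient matrix, whose
    largest eigenvalue decreases as weight moves from inside the classes to
    between them. At the optimum all of the [a * p] units of weight in the rows
    of [S] go to the other rows, on average [c = a * p / b] units to each.
    Let [lam] be the positive eigenvalue of the quotient matrix with rows [(0, p)]
    and [(c, q - c)], and [v] the vector equal to [p] on [S] and to [lam] outside.

    For every matrix [A] of the family, the Rayleigh quotient of [v] is at least
    [lam], hence [lam <= rho(A)], with equality exactly when [A] is equitable:
    no weight inside [S], and exactly [c] units from each other row into [S]
    ([two_class_bound], resting on the spectral theorem through [rayleigh]). A
    block-constant matrix attains the bound, so [lam] is the minimum over
    matrices. If a graph attains it, then [c] is the number of neighbours in [S]
    of any vertex outside [S], an integer between 1 and [q]
    ([integral_quotient]). Conversely, if [c] is such an integer, disjoint unions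
    of complete bipartite graphs on [c] and [p] vertices, completed by cliques on
    the side of the vertices of degree [q], are equitable and exist in
    arbitrarily large sizes ([biregular_minimizer]).

    Either class can play the role of [S]. If [n1 * d1 <= n2 * d2], then
    [n1 * d1 = c * n2] reads [nu = d1 / (d1 + c)] with [1 <= c <= d2]. Otherwise
    [n2 * d2 = c * n1] reads [nu = c / (d2 + c)], and the strict inequality gives
    [c <= d1 - 1]. *)

Local Notation modulus := ComplexField.Normc.normc.

(** * Spectral radius of a non-negative matrix *)

Lemma normrE_modulus (R : realType) (z : R[i]) : `|z| = real_complex R (modulus z).
Proof. by case: z. Qed.

(** A left eigenvector, taken entrywise in modulus and paired with the positive
    vector [w], gives [|z| <|v|, w> <= <|v|, A w> <= mu <|v|, w>], and the
    pairing is positive. *)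
Lemma modulus_le_subinvariant {R : realType} {n : nat} {A : 'M[R]_n}
    {w : 'I_n -> R} {mu : R} :
    (forall i j, 0 <= A i j) -> (forall i, 0 < w i) ->
    (forall i, \sum_j A i j * w j <= mu * w i) ->
  forall z : R[i], eigenvalue (map_mx (real_complex R) A) z -> modulus z <= mu.
Proof.
move=> A_ge0 w_gt0 Aw z /eigenvalueP[v vA v_neq0].
have entry j : modulus z * modulus (v 0 j) <= \sum_i modulus (v 0 i) * A i j.
  rewrite -lecR rmorphM rmorph_sum /= -!normrE_modulus -normrM.
  have -> : z * v 0 j = \sum_i v 0 i * real_complex R (A i j).
    have /rowP/(_ j) := vA; rewrite !mxE => <-.
    by apply: eq_bigr => i _; rewrite mxE.
  apply: le_trans (ler_norm_sum _ _ _) _; apply: ler_sum => i _.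
  rewrite normrM rmorphM /= -normrE_modulus.
  by rewrite (ger0_norm (x := real_complex R (A i j))) ?ler0c.
have sum_gt0 : 0 < \sum_i modulus (v 0 i) * w i.
  have [i vi] : exists i, v 0 i != 0 by apply/rV0Pn.
  have mod_ge0 k : 0 <= modulus (v 0 k) by rewrite -ler0c -normrE_modulus.
  rewrite (bigD1 i) //= ltr_pwDl //.
    rewrite mulr_gt0 // lt_def mod_ge0 andbT.
    by apply: contra_neq vi => /ComplexField.Normc.eq0_normc.
  by apply: sumr_ge0 => k _; rewrite mulr_ge0 // ltW.
rewrite -(ler_pM2r sum_gt0).
have -> : modulus z * (\sum_i modulus (v 0 i) * w i) =
          \sum_j modulus z * modulus (v 0 j) * w j.
  by rewrite mulr_sumr; apply: eq_bigr => j _; rewrite mulrA.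
apply: (@le_trans _ _ (\sum_j (\sum_i modulus (v 0 i) * A i j) * w j)).
  by apply: ler_sum => j _; rewrite ler_pM2r.
under eq_bigr do rewrite mulr_suml.
rewrite exchange_big /= mulr_sumr; apply: ler_sum => i _.
rewrite mulrCA; under eq_bigr do rewrite -mulrA.
rewrite -mulr_sumr ler_wpM2l //.
by rewrite -ler0c -normrE_modulus.
Qed.

Lemma spectral_radius_le {R : realType} {n : nat} {A : 'M[R]_n}
    {w : 'I_n -> R} {mu : R} :
    (forall i j, 0 <= A i j) -> (forall i, 0 < w i) ->
    (forall i, \sum_j A i j * w j <= mu * w i) -> 0 <= mu ->
  spectral_radius A <= mu.
Proof.
move=> A_ge0 w_gt0 Aw mu_ge0; rewrite /spectral_radius.
set S := (X in sup X).
(* The supremum of the empty set is 0; this is the case n = 0. *)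
have [->|S_neq0] := eqVneq S set0; first by rewrite sup0.
apply: ge_sup; first exact/set0P.
by move=> _ [z /= zA <-]; apply: (modulus_le_subinvariant A_ge0 w_gt0 Aw).
Qed.

Lemma eigenvalue_le_spectral_radius {R : realType} {n : nat} {A : 'M[R]_n} {z : R[i]} :
    (forall i j, 0 <= A i j) -> eigenvalue (map_mx (real_complex R) A) z ->
  modulus z <= spectral_radius A.
Proof.
move=> A_ge0 zA; apply: ub_le_sup; last by exists z.
(* The sum of all entries dominates each row sum, so the constant vector 1 is
   subinvariant and the set of moduli is bounded. *)
exists (\sum_i \sum_j A i j) => _ [y /= yA <-].
apply: (modulus_le_subinvariant A_ge0 (w := fun=> 1)) yA => // i.
have -> : \sum_j A i j * 1 = \sum_j A i j by apply: eq_bigr => j _; rewrite mulr1.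
rewrite mulr1 [leRHS](bigD1 i) /= ?lerDl //.
by apply: sumr_ge0 => k _; apply: sumr_ge0 => l _.
Qed.

Section Rayleigh.

Local Open Scope sesquilinear_scope.

(** In a unitary eigenbasis over the complex numbers, with coordinates [y] of
    [x], the gap [rho x x^T - x A x^T] is the sum of the non-negative terms
    [(rho - d k) |y k|^2]. It vanishes only if [x] is supported on the
    eigenvalues equal to [rho], that is, if [x] is an eigenvector for [rho]. *)
Lemma rayleigh {R : realType} {n : nat} {A : 'M[R]_n} (x : 'rV[R]_n) :
    A^T = A -> (forall i j, 0 <= A i j) ->
  (x *m A *m x^T) 0 0 <= spectral_radius A * (x *m x^T) 0 0
    ?= iff (x *m A == spectral_radius A *: x).
Proof.
move=> A_sym A_ge0; set rho := spectral_radius A.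
pose B := map_mx (real_complex R) A.
pose P := spectralmx B; pose d := spectral_diag B.
have B_herm : B \is hermsymmx.
  apply: realsym_hermsym.
    by apply/is_hermitianmxP; rewrite expr0 scale1r map_mx_id // /B map_trmx A_sym.
  apply/mxOverP => i j; rewrite mxE; apply/complex_realP; by exists (A i j).
have B_eq : B = P^t* *m diag_mx d *m P.
  rewrite -invmx_unitary ?spectral_unitarymx //.
  exact/orthomx_spectralP/hermitian_normalmx.
have P_unit : P \in unitmx by apply: spectral_unit.
have PP : P *m P^t* = 1%:M by apply/unitarymxP/spectral_unitarymx.
have PP' : P^t* *m P = 1%:M by apply: mulmx1C.
have PB : P *m B = diag_mx d *m P by rewrite B_eq !mulmxA PP mul1mx.
have d_real k : d 0 k \is Num.real.
  by have /mxOverP := hermitian_spectral_diag_real B_herm; apply.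
have d_le k : d 0 k <= real_complex R rho.
  apply: le_trans (real_ler_norm (d_real k)) _.
  rewrite normrE_modulus lecR; apply: eigenvalue_le_spectral_radius => //.
  apply/eigenvalueP; exists (row k P).
    by rewrite -row_mul PB row_mul row_diag_mx -scalemxAl -rowE.
  apply/eqP => rowP0; have /row_freeP[Q PQ] : row_free P by rewrite row_free_unit.
  have /rowP/(_ k) : row k (1%:M : 'M[R[i]]_n) = 0 by rewrite -PQ row_mul rowP0 mul0mx.
  by rewrite !mxE eqxx => /eqP; rewrite oner_eq0.
pose y := map_mx (real_complex R) x *m P^t*.
have xE : map_mx (real_complex R) x = y *m P by rewrite -mulmxA PP' mulmx1.
have gapE : real_complex R (rho * (x *m x^T) 0 0 - (x *m A *m x^T) 0 0) =
            \sum_k (real_complex R rho - d 0 k) * `|y 0 k| ^+ 2.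
  have xTE : map_mx (real_complex R) x^T = P^t* *m y^t*.
    rewrite -map_mxM -trmx_mul -xE.
    by apply/matrixP => k l; rewrite !mxE; apply/esym/CrealP/complex_realP; exists (x l k).
  have formE M : real_complex R ((x *m M *m x^T) 0 0) =
      (map_mx (real_complex R) x *m map_mx (real_complex R) M
         *m map_mx (real_complex R) x^T) 0 0.
    by rewrite -!map_mxM [in RHS]mxE.
  have -> : x *m x^T = x *m 1%:M *m x^T by rewrite mulmx1.
  rewrite rmorphB rmorphM /= !formE xTE -/B B_eq xE map_mx1 mulmx1.
  rewrite !mulmxA -!(mulmxA y P) PP mulmx1 -(mulmxA _ P) PP mulmx1 mxE [X in _ - X]mxE.
  rewrite mulr_sumr -sumrB; apply: eq_bigr => k _.
  have -> : (y ^t* ) k 0 = (y 0 k)^* by rewrite mxE mxE.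
  have -> : (y *m diag_mx d) 0 k = y 0 k * d 0 k by rewrite mul_mx_diag mxE.
  rewrite normCK mulrBl. ring.
have gap_ge0 k : 0 <= (real_complex R rho - d 0 k) * `|y 0 k| ^+ 2.
  by rewrite mulr_ge0 ?exprn_ge0 // subr_ge0.
split; first by rewrite -subr_ge0 -ler0c gapE sumr_ge0.
apply/eqP/eqP => [tight|->]; last by rewrite -scalemxAl mxE.
have gap0 k : (real_complex R rho - d 0 k) * `|y 0 k| ^+ 2 = 0.
  have sum0 : \sum_k (real_complex R rho - d 0 k) * `|y 0 k| ^+ 2 = 0.
    by rewrite -gapE tight subrr.
  by have /(_ k isT) := psumr_eq0P (fun i _ => gap_ge0 i) sum0.
have yD : y *m diag_mx d = real_complex R rho *: y.
  apply/rowP => k; rewrite mul_mx_diag !mxE.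
  have /eqP := gap0 k; rewrite mulf_eq0 expf_eq0 /= normr_eq0 subr_eq0.
  by case/orP => /eqP; rewrite ?mxE => ->; rewrite ?mul0r ?mulr0 // mulrC.
apply: (map_mx_inj (f := real_complex R)).
rewrite map_mxM map_mxZ -/B /= B_eq !mulmxA -/y yD.
by rewrite -scalemxAl -xE.
Qed.

End Rayleigh.

(** * Matrices with two row sums *)

Definition two_valued {R : realType} {n : nat} (S : {set 'I_n}) (x y : R) :
    'rV[R]_n :=
  \row_i (if i \in S then x else y).

(** The equation for [lam] is the characteristic equation of the quotient matrix
    with rows [(0, p)] and [(c, q - c)], whose eigenvector is [(p, lam)]. So the
    two-valued vector fails to be an eigenvector, at each index, in proportion to
    the deviation of the weight going into [S] from its equitable value: 0 for a
    row in [S], [c] for a row outside. *)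
Lemma two_valued_mulmx {R : realType} {n : nat} {S : {set 'I_n}} {p q c lam : R}
    {A : 'M[R]_n} :
    A^T = A -> (forall i, row_sum A i = if i \in S then p else q) ->
    lam ^+ 2 = (q - c) * lam + p * c ->
  forall i, (two_valued S p lam *m A) 0 i =
    lam * two_valued S p lam 0 i +
    (p - lam) * (\sum_(j in S) A i j - if i \in S then 0 else c).
Proof.
move=> A_sym A_sum lamE i.
have -> : (two_valued S p lam *m A) 0 i =
          lam * row_sum A i + (p - lam) * \sum_(j in S) A i j.
  rewrite mxE /row_sum !mulr_sumr [X in _ + X]big_mkcond -big_split /=.
  apply: eq_bigr => j _; rewrite mxE -[in LHS]A_sym mxE.
  by case: ifP => _; ring.
rewrite A_sum mxE; case: ifP => _; first by ring.
by rewrite -expr2 lamE; ring.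
Qed.

(** The balance condition makes the weight leaving [S] equal to [c] units per
    outside row if no weight stays inside [S]; every unit of weight inside [S]
    is then missing from the outside rows, and the two effects add up to the
    square [(p - lam) ^+ 2]. *)
Lemma sum_two_classes {R : realType} {n : nat} {S : {set 'I_n}} {p q c lam : R}
    {A : 'M[R]_n} :
    A^T = A -> (forall i, row_sum A i = if i \in S then p else q) ->
    lam ^+ 2 = (q - c) * lam + p * c -> #|S|%:R * p = c * #|~: S|%:R ->
  let v := two_valued S p lam in
  (v *m A *m v^T) 0 0 =
    lam * (v *m v^T) 0 0 + (p - lam) ^+ 2 * \sum_(i in S) \sum_(j in S) A i j.
Proof.
move=> A_sym A_sum lamE balance v.
pose a i := \sum_(j in S) A i j.
have cross : \sum_(i in ~: S) (a i - c) = - \sum_(i in S) a i.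
  have outE : \sum_(i in ~: S) a i = \sum_(j in S) (p - a j).
    rewrite /a exchange_big /=; apply: eq_bigr => j jS.
    have <- : row_sum A j = p by rewrite A_sum jS.
    rewrite /row_sum [X in X - _](bigID [in S]) /= addrAC subrr add0r.
    by apply: eq_big => [i|i _]; rewrite ?inE // -[in LHS]A_sym mxE.
  rewrite sumrB outE sumrB !sumr_const -(mulr_natr p) -(mulr_natr c).
  rewrite mulrC balance; ring.
have -> : (v *m A *m v^T) 0 0 =
   lam * (v *m v^T) 0 0 + (p - lam) * (\sum_i (a i - if i \in S then 0 else c) * v 0 i).
  rewrite [(v *m A *m v^T) 0 0]mxE [(v *m v^T) 0 0]mxE !mulr_sumr -big_split /=.
  apply: eq_bigr => i _; rewrite (two_valued_mulmx A_sym A_sum lamE) -/v -/(a i).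
  by rewrite [v^T i 0]mxE; move: (a i - _) => t; ring.
have -> : \sum_i (a i - if i \in S then 0 else c) * v 0 i = (p - lam) * \sum_(i in S) a i.
  rewrite (bigID [in S]) /=.
  have -> : \sum_(i in S) (a i - if i \in S then 0 else c) * v 0 i = p * \sum_(i in S) a i.
    by rewrite mulr_sumr; apply: eq_bigr => i iS; rewrite mxE iS subr0 mulrC.
  have -> : \sum_(i | i \notin S) (a i - if i \in S then 0 else c) * v 0 i =
            lam * \sum_(i in ~: S) (a i - c).
    rewrite mulr_sumr; apply: eq_big => [i|i /negbTE iS]; first by rewrite inE.
    by rewrite mxE iS mulrC.
  by rewrite cross; ring.
by ring.
Qed.

(** The lower bound is the Rayleigh quotient of the two-valued vector. In the
    case of equality this vector is an eigenvector for [lam], and since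
    [lam != p] each of its defects vanishes; conversely an equitable matrix has
    it as a positive eigenvector, which bounds the spectral radius by [lam]. *)
Lemma two_class_bound {R : realType} {n : nat} {S : {set 'I_n}} {p q c lam : R}
    {A : 'M[R]_n} :
    (0 < n)%N -> A^T = A -> (forall i j, 0 <= A i j) ->
    (forall i, row_sum A i = if i \in S then p else q) ->
    #|S|%:R * p = c * #|~: S|%:R ->
    lam ^+ 2 = (q - c) * lam + p * c -> 0 < p -> 0 < lam -> lam != p ->
  lam <= spectral_radius A
    ?= iff [forall i, \sum_(j in S) A i j == if i \in S then 0 else c].
Proof.
move=> n_gt0 A_sym A_ge0 A_sum balance lamE p_gt0 lam_gt0 lam_neq.
pose v := two_valued S p lam.
have v_gt0 i : 0 < v 0 i by rewrite mxE; case: ifP.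
have vv_gt0 : 0 < (v *m v^T) 0 0.
  have -> : (v *m v^T) 0 0 = \sum_i v 0 i * v 0 i.
    by rewrite mxE; apply: eq_bigr => i _; rewrite [v^T _ _]mxE.
  rewrite (bigD1 (Ordinal n_gt0)) //= ltr_pwDl ?mulr_gt0 //.
  by apply: sumr_ge0 => i _; rewrite mulr_ge0 // ltW.
have [quad_le quad_eq] := rayleigh v A_sym A_ge0.
have quadE := sum_two_classes A_sym A_sum lamE balance; rewrite -/v in quadE.
have inner_ge0 : 0 <= \sum_(i in S) \sum_(j in S) A i j.
  by apply: sumr_ge0 => i _; apply: sumr_ge0.
have lam_quad : lam * (v *m v^T) 0 0 <= (v *m A *m v^T) 0 0.
  by rewrite quadE lerDl mulr_ge0 // sqr_ge0.
have lam_le : lam <= spectral_radius A.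
  by rewrite -(ler_pM2r vv_gt0); apply: le_trans lam_quad quad_le.
split=> //; apply/eqP/forallP => [lam_rho i|equitable].
  have /eqP/rowP/(_ i) : v *m A == lam *: v.
    by rewrite lam_rho -quad_eq eq_le quad_le -lam_rho lam_quad.
  rewrite (two_valued_mulmx A_sym A_sum lamE) -/v [RHS]mxE => /eqP.
  rewrite addrC -subr_eq0 addrK mulf_eq0 subr_eq0 eq_sym (negbTE lam_neq) /=.
  by rewrite subr_eq0.
apply: le_anti; rewrite lam_le /=.
apply: (spectral_radius_le (w := v 0)) => // [i|]; last exact: ltW.
have <- : (v *m A) 0 i = \sum_j A i j * v 0 j.
  by rewrite mxE; apply: eq_bigr => j _; rewrite mulrC -[in RHS]A_sym [A^T _ _]mxE.
by rewrite (two_valued_mulmx A_sym A_sum lamE) (eqP (equitable i)) subrr mulr0 addr0.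
Qed.

(** The value [lam = p] would force [p = q]: a constant eigenvector requires
    constant row sums. *)
Lemma exists_quotient_eigenvalue {R : realType} (p q c : R) :
    0 < p -> 0 < c -> p != q ->
  exists lam : R, [/\ lam ^+ 2 = (q - c) * lam + p * c, 0 < lam & lam != p].
Proof.
move=> p_gt0 c_gt0 pq.
pose s := Num.sqrt ((q - c) ^+ 2 + 4 * (p * c)).
have pc : 0 < p * c by rewrite mulr_gt0.
have sE : s ^+ 2 = (q - c) ^+ 2 + 4 * (p * c).
  by rewrite sqr_sqrtr // addr_ge0 ?sqr_ge0 // mulr_ge0 // ltW.
have s_gt : `|q - c| < s.
  rewrite -sqrtr_sqr ltr_sqrt; first by rewrite ltrDl mulr_gt0.
  by rewrite ltr_wpDl ?sqr_ge0 ?mulr_gt0.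
have lamE : ((q - c + s) / 2) ^+ 2 = (q - c) * ((q - c + s) / 2) + p * c.
  have -> : ((q - c + s) / 2) ^+ 2 = ((q - c) ^+ 2 + 2 * (q - c) * s + s ^+ 2) / 4 by field.
  by rewrite sE; field.
exists ((q - c + s) / 2); split => //.
  by have := ler_norm (- (q - c)); rewrite normrN; lra.
apply: contra pq => /eqP lamp; move: lamE; rewrite lamp => lamE.
have p_neq0 : p != 0 by rewrite gt_eqF.
by apply/eqP/(mulIf p_neq0); rewrite -expr2 lamE; ring.
Qed.

(** * Families with two prescribed row sums or degrees *)

(** The size [N] is a variable here, and not the literal sum [a + b], so that the
    roles of the two classes can be exchanged without casting between
    ['I_(a + b)] and ['I_(b + a)]. *)
Definition two_sum_matrix {R : realType} {N : nat} (p a q b : nat) (A : 'M[R]_N) : Prop :=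
  [/\ A^T = A, forall i j, 0 <= A i j,
      #|[set i | row_sum A i == p%:R]%SET| = a &
      #|[set i | row_sum A i == q%:R]%SET| = b].

Definition two_degree_graph {N : nat} (p a q b : nat) (e : rel 'I_N) : Prop :=
  [/\ symmetric e, irreflexive e,
      #|[set i | degree e i == p]%SET| = a &
      #|[set i | degree e i == q]%SET| = b].

Definition graph_minimizer (R : realType) (N p a q b : nat) : Prop :=
  exists2 e : rel 'I_N, two_degree_graph p a q b e &
    forall A : 'M[R]_N, two_sum_matrix p a q b A ->
      spectral_radius (adjacency R e) <= spectral_radius A.

Lemma graph_minimizerC (R : realType) (N p a q b : nat) :
  graph_minimizer R N p a q b -> graph_minimizer R N q b p a.
Proof.
case=> e [e_sym e_irr ep eq] e_min; exists e; first by split.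
by move=> A [A_sym A_ge0 Aq Ap]; apply: e_min; split.
Qed.

Lemma row_sum_adjacency {R : realType} {N : nat} (e : rel 'I_N) (i : 'I_N) :
  row_sum (adjacency R e) i = (degree e i)%:R.
Proof.
rewrite /row_sum /degree -sum1_card natr_sum [RHS]big_mkcond /=.
by apply: eq_bigr => j _; rewrite mxE inE; case: (e i j).
Qed.

Lemma two_sum_adjacency (R : realType) {N p a q b : nat} {e : rel 'I_N} :
  two_degree_graph p a q b e -> two_sum_matrix p a q b (adjacency R e).
Proof.
case=> e_sym _ ep eq.
have cardE d : #|[set i | row_sum (adjacency R e) i == d%:R]%SET| =
               #|[set i | degree e i == d]%SET|.
  by apply: eq_card => i; rewrite !inE row_sum_adjacency eqr_nat.
split; rewrite ?cardE //; last by move=> i j; rewrite mxE ler0n.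
by apply/matrixP => i j; rewrite !mxE e_sym.
Qed.

(** Adjacency matrices belong to the matrix family, so a graph that is minimal
    among matrices is also minimal among graphs. *)
Lemma rho_eqP (R : realType) (d1 n1 d2 n2 : nat) :
  rho_G_eq_rho_M R d1 n1 d2 n2 <-> graph_minimizer R (n1 + n2) d1 n1 d2 n2.
Proof.
split.
  case=> r [[[e eG rE] _] [_ r_min]]; exists e; first exact: eG.
  move=> A AM; have := r_min (spectral_radius A).
  rewrite rE; apply.
  exists A.
    exact: AM.
  reflexivity.
case=> e eG e_min; have AG := two_sum_adjacency R eG.
exists (spectral_radius (adjacency R e)); split; split.
- exists e; [exact: eG|by []].
- move=> _ [e' e'G ->]; exact/e_min/two_sum_adjacency.
- exists (adjacency R e); [exact: AG|by []].
- by move=> _ [A AM ->]; exact: e_min.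
Qed.

Lemma two_classes {N a b : nat} {T : eqType} {f : 'I_N -> T} {x y : T} :
    N = (a + b)%N -> x != y -> #|[set i | f i == x]%SET| = a ->
    #|[set i | f i == y]%SET| = b ->
  let S := [set i | f i == x]%SET in
  #|~: S| = b /\ forall i, f i = if i \in S then x else y.
Proof.
move=> NE xy Sa Tb S.
have compl_card : #|~: S| = b by rewrite cardsCs finset.setCK card_ord Sa NE addKn.
split=> // i; rewrite inE; case: eqP => // /eqP fx; apply/eqP.
have /setP/(_ i) : [set i | f i == y]%SET = ~: S.
  apply/eqP; rewrite eqEcard compl_card Tb leqnn andbT.
  by apply/fintype.subsetP => j; rewrite !inE => /eqP ->; rewrite eq_sym.
by rewrite !inE fx.
Qed.

Lemma two_sum_bound {R : realType} {N p a q b : nat} {c lam : R} {A : 'M[R]_N} :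
    N = (a + b)%N -> (0 < N)%N -> p != q -> two_sum_matrix p a q b A ->
    a%:R * p%:R = c * b%:R -> lam ^+ 2 = (q%:R - c) * lam + p%:R * c ->
    (0 < p)%N -> 0 < lam -> lam != p%:R ->
  let S := [set i | row_sum A i == p%:R]%SET in
  lam <= spectral_radius A
    ?= iff [forall i, \sum_(j in S) A i j == if i \in S then 0 else c].
Proof.
move=> NE N_gt0 pq [A_sym A_ge0 Ap Aq] balance lamE p_gt0 lam_gt0 lam_neq S.
have pqR : p%:R != q%:R :> R by rewrite eqr_nat.
have [Sc sumE] := two_classes NE pqR Ap Aq.
by apply: (two_class_bound N_gt0 A_sym A_ge0 sumE) => //; rewrite ?Ap ?Sc ?ltr0n.
Qed.

(** * Equality forces an integral quotient *)

Definition block_matrix {R : realType} {N : nat} (S : {set 'I_N}) (x y : R) : 'M[R]_N :=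
  \matrix_(i, j) if i \in S then (if j \in S then 0 else x)
                 else (if j \in S then x else y).

Lemma sum_block_matrix {R : realType} {N : nat} (S : {set 'I_N}) (x y : R) i :
  \sum_(j in S) block_matrix S x y i j = (if i \in S then 0 else x) * #|S|%:R.
Proof.
rewrite mulr_natr -sumr_const; apply: eq_bigr => j jS.
by rewrite mxE jS.
Qed.

Lemma row_sum_block_matrix {R : realType} {N : nat} (S : {set 'I_N}) (x y : R) i :
  row_sum (block_matrix S x y) i =
    (if i \in S then 0 else x) * #|S|%:R + (if i \in S then x else y) * #|~: S|%:R.
Proof.
rewrite /row_sum (bigID [in S]) /= sum_block_matrix; congr (_ + _).
rewrite mulr_natr -sumr_const; apply: eq_big => [j|j /negbTE jS]; rewrite ?inE //.
by rewrite mxE jS.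
Qed.

(** This block matrix is the real relaxation of the extremal graphs: nothing
    inside [S], and all remaining weight spread uniformly. It exists for any real
    [c <= q], which is what makes the lower bound sharp over matrices. *)
Lemma two_sum_block {R : realType} {N p a q b : nat} {c : R} {S : {set 'I_N}} :
    p != q -> (0 < b)%N -> #|S| = a -> #|~: S| = b ->
    a%:R * p%:R = c * b%:R -> c <= q%:R ->
  let A := block_matrix S (p%:R / b%:R) ((q%:R - c) / b%:R) in
  two_sum_matrix p a q b A /\ [set i | row_sum A i == p%:R]%SET = S.
Proof.
move=> pq b_gt0 Sa Sb balance cq A.
have b_neq0 : b%:R != 0 :> R by rewrite pnatr_eq0 -lt0n.
have pqR : (p%:R == q%:R :> R) = false by rewrite eqr_nat (negbTE pq).
have sumE i : row_sum A i = if i \in S then p%:R else q%:R.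
  rewrite row_sum_block_matrix Sa Sb; case: ifP => _.
    by rewrite mul0r add0r divfK.
  by rewrite divfK // mulrAC [p%:R * _]mulrC balance mulfK //; ring.
have SE : [set i | row_sum A i == p%:R]%SET = S.
  by apply/setP => i; rewrite inE sumE; case: ifP; rewrite ?eqxx // eq_sym pqR.
split=> //; split; rewrite ?SE //.
- by apply/matrixP => i j; rewrite !mxE; do 2!case: ifP.
- move=> i j; rewrite mxE.
  by do 2!case: ifP => _; rewrite // divr_ge0 ?ler0n // subr_ge0.
- rewrite -Sb; apply: eq_card => i; rewrite !inE sumE.
  by case: ifP; rewrite ?eqxx ?pqR.
Qed.

(** The block matrix attains the lower bound, so a minimizing graph attains it as
    well and is equitable: any vertex of degree [q] has exactly [a * p / b]
    neighbours of degree [p], so that this quotient is an integer. *)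
Lemma integral_quotient {R : realType} {N p a q b : nat} :
    N = (a + b)%N -> p != q -> (0 < p)%N -> (0 < a)%N -> (0 < b)%N ->
    (a * p <= b * q)%N -> graph_minimizer R N p a q b ->
  exists k, (0 < k <= q)%N /\ (a * p = b * k)%N.
Proof.
move=> NE pq p_gt0 a_gt0 b_gt0 apbq [e eG e_min].
have N_gt0 : (0 < N)%N by rewrite NE addn_gt0 a_gt0.
have bR : 0 < b%:R :> R by rewrite ltr0n.
pose c : R := a%:R * p%:R / b%:R.
have balance : a%:R * p%:R = c * b%:R by rewrite divfK ?gt_eqF.
have c_gt0 : 0 < c by rewrite divr_gt0 ?mulr_gt0 ?ltr0n.
have cq : c <= q%:R by rewrite ler_pdivrMr // -!natrM ler_nat [(q * b)%N]mulnC.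
have [||lam [lamE lam_gt0 lam_neq]] := @exists_quotient_eigenvalue R p%:R q%:R c _ c_gt0.
- by rewrite ltr0n.
- by rewrite eqr_nat.
have [_ _ ep eq] := eG.
have [Sb degE] := two_classes NE pq ep eq.
set S := [set i | _]%SET in ep Sb degE.
have [MM SE] := two_sum_block pq b_gt0 ep Sb balance cq.
set M := block_matrix _ _ _ in MM SE.
have rhoM : lam = spectral_radius M.
  apply/eqP; rewrite (two_sum_bound NE N_gt0 pq MM balance lamE) //; apply/forallP => i.
  rewrite SE sum_block_matrix ep; case: ifP => _; first by rewrite mul0r.
  by rewrite /c mulrAC [p%:R * _]mulrC.
have AG := two_sum_adjacency R eG.
have [lam_le lam_eq] := two_sum_bound NE N_gt0 pq AG balance lamE p_gt0 lam_gt0 lam_neq.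
have /eqP : lam = spectral_radius (adjacency R e).
  by apply: le_anti; rewrite lam_le [in leRHS]rhoM e_min.
rewrite lam_eq => /forallP equitable.
have [j jS] : exists j, j \in ~: S by apply/card_gt0P; rewrite Sb.
pose k := #|[set i in S | e j i]%SET|.
have ck : c = k%:R.
  have /eqP := equitable j.
  have -> : [set i | row_sum (adjacency R e) i == p%:R]%SET = S.
    by apply/setP => i; rewrite !inE row_sum_adjacency eqr_nat.
  move: (jS); rewrite finset.in_setC => /negbTE -> <-.
  rewrite /k -sum1_card natr_sum big_mkcond [RHS]big_mkcond /=.
  by apply: eq_bigr => i _; rewrite mxE [in RHS]inE; case: (i \in S); case: (e j i).
exists k; split.
  rewrite -(ltr0n R) -ck c_gt0 /=.
  have <- : degree e j = q by rewrite degE; move: jS; rewrite finset.in_setC => /negbTE ->.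
  by apply/subset_leq_card/fintype.subsetP => i; rewrite !inE => /andP[].
by apply/eqP; rewrite -(eqr_nat R) !natrM balance ck mulrC.
Qed.

(** * Extremal graphs for an integral quotient *)

Section Gadget.
Variables L h k p : nat.

(** The vertices [inl] have degree [p], the vertices [inr] have degree [k + h].
    Each pair [(l, s)] carries a complete bipartite graph between [k] vertices
    [inl] and [p] vertices [inr]; for fixed [l] and [b], the [h + 1] vertices
    [inr (l, s, b)] form a clique, which adds [h] to their degree. *)
Definition gadget_vertex : finType :=
  ('I_L * 'I_h.+1 * 'I_k + 'I_L * 'I_h.+1 * 'I_p)%type.

Definition gadget : rel gadget_vertex := fun u v =>
  match u, v with
  | inl x, inr y | inr y, inl x => x.1 == y.1
  | inr x, inr y => [&& x.1.1 == y.1.1, x.1.2 != y.1.2 & x.2 == y.2]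
  | inl _, inl _ => false
  end.

Lemma gadget_sym : symmetric gadget.
Proof.
case=> x [] y //=; rewrite eq_sym //.
by rewrite [x.1.2 == _]eq_sym [x.2 == _]eq_sym.
Qed.

Lemma gadget_irr : irreflexive gadget.
Proof. by case=> x //=; rewrite !eqxx. Qed.

Definition is_hub (u : gadget_vertex) : bool := if u is inl _ then true else false.

Lemma card_hub : #|[set u | is_hub u]%SET| = (L * h.+1 * k)%N.
Proof.
have -> : [set u | is_hub u]%SET = inl @: [set: 'I_L * 'I_h.+1 * 'I_k]%SET.
  apply/setP => -[x|y]; rewrite !inE /=; first by rewrite mem_imset ?inE // => u v [].
  by apply/esym/imsetP => -[].
by rewrite card_imset ?cardsT ?card_prod ?card_ord // => u v [].
Qed.

Lemma card_gadget_hub x : #|[set v | gadget (inl x) v]%SET| = p.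
Proof.
have -> : [set v | gadget (inl x) v]%SET = (fun b => inr (x.1, b)) @: [set: 'I_p]%SET.
  apply/setP => -[y|[y b]]; rewrite !inE /=.
    by apply/esym/imsetP => -[].
  by apply/eqP/imsetP => [->|[c _ [-> _]] //]; exists b; rewrite ?inE.
by rewrite card_imset ?cardsT ?card_ord // => b c [].
Qed.

Lemma card_gadget_rim_hub x : #|[set v | gadget (inr x) v && is_hub v]%SET| = k.
Proof.
have -> : [set v | gadget (inr x) v && is_hub v]%SET =
          (fun a => inl (x.1, a)) @: [set: 'I_k]%SET.
  apply/setP => -[[y a]|y]; rewrite !inE /= ?andbT ?andbF.
    by apply/eqP/imsetP => [->|[c _ [-> _]] //]; exists a; rewrite ?inE.
  by apply/esym/imsetP => -[].
by rewrite card_imset ?cardsT ?card_ord // => b c [].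
Qed.

Lemma card_gadget_rim_rim x : #|[set v | gadget (inr x) v && ~~ is_hub v]%SET| = h.
Proof.
have -> : [set v | gadget (inr x) v && ~~ is_hub v]%SET =
          (fun s => inr (x.1.1, s, x.2)) @: [set~ x.1.2]%SET.
  case: x => -[l s] b; apply/setP => -[y|[[l' s'] b']]; rewrite !inE /= ?andbT ?andbF.
    by apply/esym/imsetP => -[].
  apply/and3P/imsetP => [[/eqP <- ss /eqP <-]|[t + [-> -> ->]]].
    by exists s' => //; rewrite !inE eq_sym.
  by rewrite !inE eq_sym.
by rewrite card_imset ?cardsC1 ?card_ord // => s t [].
Qed.

Lemma card_gadget_rim x : #|[set v | gadget (inr x) v]%SET| = (k + h)%N.
Proof.
rewrite -(cardsID [set v | is_hub v]%SET); congr (_ + _)%N.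
  rewrite -[RHS](card_gadget_rim_hub x).
  by apply: eq_card => v; rewrite !inE.
rewrite -[RHS](card_gadget_rim_rim x).
by apply: eq_card => v; rewrite !inE andbC.
Qed.

End Gadget.

Arguments gadget {L h k p}.
Arguments is_hub {L h k p}.

(** Transport the gadget to ordinals, with [h = q - k]. It is equitable, hence
    attains the lower bound valid for all matrices of the family. *)
Lemma biregular_minimizer (R : realType) (L p q k : nat) :
    p != q -> (0 < L)%N -> (0 < p)%N -> (0 < k <= q)%N ->
  let a := (L * (q - k).+1 * k)%N in let b := (L * (q - k).+1 * p)%N in
  graph_minimizer R (a + b) p a q b.
Proof.
move=> pq L_gt0 p_gt0 /andP[k_gt0 kq] a b.
set h := (q - k)%N in a b *.
pose T := gadget_vertex L h k p.
have cardT : (a + b)%N = #|T| by rewrite card_sum !card_prod !card_ord.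
pose f (i : 'I_(a + b)) : T := enum_val (cast_ord cardT i).
have f_inj : injective f by move=> i j /enum_val_inj/cast_ord_inj.
have f_bij : bijective f by apply: inj_card_bij f_inj _; rewrite card_ord cardT.
have card_f (P : pred T) : #|[set i | P (f i)]%SET| = #|[set v | P v]%SET|.
  rewrite -[RHS](on_card_preimset (f := f)); last by case: f_bij => g *; exists g => ? _.
  by apply: eq_card => i; rewrite !inE.
pose e : rel 'I_(a + b) := fun i j => gadget (f i) (f j).
have degE i : degree e i = if is_hub (f i) then p else q.
  rewrite /degree (card_f (gadget (f i))).
  case: (f i) => x /=; first exact: card_gadget_hub.
  by rewrite card_gadget_rim subnKC.
have e_p : #|[set i | degree e i == p]%SET| = a.
  rewrite [RHS](_ : _ = #|[set v : T | is_hub v]%SET|); last by rewrite card_hub.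
  rewrite -card_f; apply: eq_card => i; rewrite !inE degE.
  by case: ifP; rewrite ?eqxx // eq_sym (negbTE pq).
have e_q : #|[set i | degree e i == q]%SET| = b.
  have -> : [set i | degree e i == q]%SET = ~: [set i | degree e i == p]%SET.
    by apply/setP => i; rewrite !inE degE; case: ifP; rewrite ?eqxx ?(negbTE pq) // eq_sym pq.
  by rewrite cardsCs finset.setCK card_ord e_p addKn.
have eG : two_degree_graph p a q b e.
  by split=> // [i j|i]; rewrite /e; [exact: gadget_sym|exact: gadget_irr].
exists e; first exact: eG.
move=> A AM.
have ab_gt0 : (0 < a + b)%N by rewrite addn_gt0 !muln_gt0 L_gt0 k_gt0.
have balance : a%:R * p%:R = k%:R * b%:R :> R.
  by rewrite -!natrM /a /b; congr (_%:R); ring.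
have [||| lam [lamE lam_gt0 lam_neq]] := @exists_quotient_eigenvalue R p%:R q%:R k%:R.
- by rewrite ltr0n.
- by rewrite ltr0n.
- by rewrite eqr_nat.
have AG := two_sum_adjacency R eG.
have <- : lam = spectral_radius (adjacency R e).
  apply/eqP; rewrite (two_sum_bound _ ab_gt0 pq AG balance lamE) //.
  apply/forallP => i; apply/eqP.
  have -> : \sum_(j in [set i | row_sum (adjacency R e) i == p%:R]%SET) adjacency R e i j =
            #|[set v | gadget (f i) v && is_hub v]%SET|%:R.
    rewrite -(card_f (fun v => gadget (f i) v && is_hub v)) -sum1_card natr_sum.
    rewrite big_mkcond [RHS]big_mkcond /=; apply: eq_bigr => j _.
    rewrite mxE !inE row_sum_adjacency eqr_nat degE /e.
    by case: (is_hub (f j)); rewrite ?eqxx ?[q == p]eq_sym ?(negbTE pq) andbC /=;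
      case: (gadget (f i) (f j)).
  rewrite !inE row_sum_adjacency eqr_nat degE.
  case: (f i) => x /=; rewrite ?eqxx ?[q == p]eq_sym ?(negbTE pq).
    apply/eqP; rewrite (eqr_nat R _ 0) cards_eq0; apply/eqP/setP => -[y|y].
      by rewrite !inE.
    by rewrite !inE andbF.
  by rewrite card_gadget_rim_hub.
by have [] := two_sum_bound erefl ab_gt0 pq AM balance lamE p_gt0 lam_gt0 lam_neq.
Qed.

Lemma equality_at_block (R : realType) (d1 d2 n1 n2 : nat) (nu : rat) :
    (0 < n1 + n2)%N -> nu * (n1 + n2)%:R = n2%:R ->
    graph_minimizer R (n1 + n2) d1 n1 d2 n2 ->
  equality_at R d1 d2 nu (n1 + n2).
Proof.
move=> n_gt0 nuE G_min; split=> //; exists n1, n2; split=> //.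
  by rewrite mulrBl nuE mul1r natrD addrK.
exact/rho_eqP.
Qed.

(** * Characterization of the ratios *)

Theorem theorem1p7 (R : realType) (d1 d2 : nat) (hd1 : (0 < d1)%N)
    (hd2 : (0 < d2)%N) (hd : d1 <> d2) (nu : rat) (hnu : 0 < nu < 1) :
  ((exists n : nat, equality_at R d1 d2 nu n) <-> critical_ratios d1 d2 nu) /\
  (critical_ratios d1 d2 nu ->
   infinite_set [set n : nat | equality_at R d1 d2 nu n]).
Proof.
have d12 : d1 != d2 by apply/eqP.
(* The free factor L is the number of copies of the gadget. *)
have construction : critical_ratios d1 d2 nu ->
    exists2 m, (0 < m)%N & forall L, (0 < L)%N -> equality_at R d1 d2 nu (L * m).
  case=> -[i /= /andP[i_gt0 i_le] <-].
    exists ((d1 - i).+1 * (d2 + i))%N => [|L L_gt0].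
      by rewrite muln_gt0 addn_gt0 hd2.
    have -> : (L * ((d1 - i).+1 * (d2 + i)) =
               L * (d1 - i).+1 * d2 + L * (d1 - i).+1 * i)%N by ring.
    apply: equality_at_block.
    - by rewrite addn_gt0 !muln_gt0 L_gt0 hd2.
    - rewrite -mulnDr natrM mulrCA divfK ?natrM //.
      by rewrite pnatr_eq0 -lt0n addn_gt0 hd2.
    rewrite addnC; apply/graph_minimizerC/biregular_minimizer => //.
      by rewrite eq_sym.
    by rewrite i_gt0 (leq_trans i_le) ?leq_subr.
  exists ((d2 - i).+1 * (d1 + i))%N => [|L L_gt0].
    by rewrite muln_gt0 addn_gt0 hd1.
  have -> : (L * ((d2 - i).+1 * (d1 + i)) =
             L * (d2 - i).+1 * i + L * (d2 - i).+1 * d1)%N by ring.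
  apply: equality_at_block.
  - by rewrite addn_gt0 !muln_gt0 L_gt0 i_gt0.
  - rewrite -mulnDr [(i + d1)%N]addnC natrM mulrCA divfK ?natrM //.
    by rewrite pnatr_eq0 -lt0n addn_gt0 hd1.
  by apply: biregular_minimizer => //; rewrite i_gt0.
split; [split=> [|crit]|move=> crit]; last first.
- have [m m_gt0 eqs] := construction crit.
  move=> fin; apply: infinite_nat.
  apply: sub_finite_set (finite_preimage (f := fun L => (L.+1 * m)%N) _ fin).
    by move=> L _ /=; apply: eqs.
  by move=> L L' _ _ /eqP; rewrite eqn_pmul2r // eqSS => /eqP.
- have [m m_gt0 eqs] := construction crit.
  by exists (1 * m)%N; apply: eqs.
case=> n [n_gt0 [n1 [n2 [n1E n2E /rho_eqP G_min]]]].
have /andP[nu_gt0 nu_lt1] := hnu.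
have n1_gt0 : (0 < n1)%N by rewrite -(ltr0n rat) n1E mulr_gt0 ?ltr0n ?subr_gt0.
have n2_gt0 : (0 < n2)%N by rewrite -(ltr0n rat) n2E mulr_gt0 ?ltr0n.
have nuE : nu * (n1 + n2)%:R = n2%:R by rewrite natrD n1E n2E; ring.
have nu_ratio x y : (0 < y)%N -> (n2 * y = x * (n1 + n2))%N -> x%:R / y%:R = nu.
  move=> y_gt0 xy; have y_neq0 : y%:R != 0 :> rat by rewrite pnatr_eq0 -lt0n.
  have s_neq0 : (n1 + n2)%:R != 0 :> rat by rewrite pnatr_eq0 -lt0n addn_gt0 n1_gt0.
  apply: (mulIf s_neq0); rewrite nuE mulrAC -natrM -xy natrM mulfK //.
have [le12|lt21] := leqP (n1 * d1) (n2 * d2).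
  have [k [/andP[k_gt0 kd2] kE]] :=
    integral_quotient erefl d12 hd1 n1_gt0 n2_gt0 le12 G_min.
  right; exists k => /=; first by rewrite k_gt0.
  by apply: nu_ratio; [rewrite addn_gt0 hd1|rewrite mulnDr -kE; ring].
have d21 : d2 != d1 by rewrite eq_sym.
have [k [/andP[k_gt0 kd1] kE]] :=
  integral_quotient (addnC n1 n2) d21 hd2 n2_gt0 n1_gt0 (ltnW lt21)
    (graph_minimizerC _ _ _ _ _ _ G_min).
left; exists k => /=.
  rewrite k_gt0 -ltnS subn1 prednK // ltn_neqAle kd1 andbT.
  by apply: contraTneq lt21 => kd; rewrite -kd -kE ltnn.
by apply: nu_ratio; [rewrite addn_gt0 hd2|rewrite mulnDr kE; ring].
Qed.
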